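(* There exist a countable group $G$ and an ergodic totally non-free (measure-preserving) action of $G$ on a Lebesgue space $(X,\mu)$ such that the corresponding character $\chi(g)=\mu(\mathrm{Fix}(g))$, $g\in G$, is not indecomposable.
   Context: A Lebesgue space is a standard probability space. $\mathrm{Fix}(g)=\{x\in X:gx=x\}$. A measure-preserving action of a countable group $G$ on a Lebesgue space $(X,\Sigma,\mu)$ is totally non-free if the collection of sets $\mathrm{Fix}(g)$, $g\in G$, together with the sets of zero measure generates the sigma-algebra $\Sigma$. A character on $G$ is a function $\chi:G\to\mathbb C$ with $\chi(g_1g_2)=\chi(g_2g_1)$ for all $g_1,g_2$, positive semi-definite matrices $(\chi(g_ig_j^{-1}))_{i,j=1}^n$ for all $n\ge1$ and $g_1,\dots,g_n\in G$, and $\chi(e)=1$; it is indecomposable if it cannot be written as $\alpha\chi_1+(1-\alpha)\chi_2$ with $0<\alpha<1$ and $\chi_1,\chi_2$ distinct characters. *)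

(* Defs.v *)
From HB Require Import structures.
From mathcomp Require Import all_boot all_order all_algebra.
From mathcomp Require Import all_classical all_reals all_analysis.
From mathcomp Require Export complex.

Set Implicit Arguments.
Unset Strict Implicit.
Unset Printing Implicit Defensive.

Import Order.TTheory GRing.Theory Num.Theory.
Import numFieldNormedType.Exports.

Local Open Scope classical_set_scope.
Local Open Scope ring_scope.

(* Isomorphism mod 0 of the measurable parts A of (X, mu) and B of (Y, nu):
   a bijection of conull subsets, bimeasurable and measure preserving. *)
Definition isomorphic_mod0 (R : realType) d1 d2
    (X : measurableType d1) (Y : measurableType d2)
    (mu : set X -> \bar R) (A : set X) (nu : set Y -> \bar R) (B : set Y) :=
  exists (E : set X) (F : set Y) (f : X -> Y),
    [/\ [/\ measurable E, E `<=` A & mu (A `\` E) = 0%E],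
        [/\ measurable F, F `<=` B & nu (B `\` F) = 0%E],
        set_bij E F f,
        forall S, S `<=` E -> (measurable S <-> measurable (f @` S)) &
        forall S, S `<=` E -> measurable S -> mu S = nu (f @` S)].

(* Lebesgue space (standard probability space) in the sense of Rokhlin: a
   complete probability space consisting, mod 0, of an interval with the
   (complete) Lebesgue measure together with countably many points; either
   part may be absent. *)
Definition lebesgue_space (R : realType) d (X : measurableType d)
    (mu : probability X R) :=
  measure_is_complete mu /\
  exists D : set X,
    [/\ countable D,
        forall x, D x -> measurable [set x] &
        isomorphic_mod0 mu (~` D) (@completed_lebesgue_measure R)
          `[0, fine (mu (~` D))]].

Definition measure_preserving_action (G : groupType) (R : realType) d
    (X : measurableType d) (mu : probability X R) (act : G -> X -> X) :=
  [/\ forall x, act 1%g x = x,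
      forall g h x, act (g * h)%g x = act g (act h x),
      forall g, measurable_fun [set: X] (act g) &
      forall g A, measurable A -> mu (act g @^-1` A) = mu A].

Definition ergodic (G : groupType) (R : realType) d
    (X : measurableType d) (mu : probability X R) (act : G -> X -> X) :=
  forall A, measurable A -> (forall g, act g @^-1` A = A) ->
    mu A = 0%E \/ mu A = 1%E.

Definition fixed_points (G X : Type) (act : G -> X -> X) (g : G) : set X :=
  [set x | act g x = x].

Definition totally_non_free (G : groupType) (R : realType) d
    (X : measurableType d) (mu : probability X R) (act : G -> X -> X) :=
  <<s range (fixed_points act) `|` [set N | measurable N /\ mu N = 0%E] >>
  = @measurable d X.

(* 0 <= z in R[i] means that z is real and nonnegative; over the complex
   numbers this makes M Hermitian. *)
Definition psdmx (R : realType) n (M : 'M[R[i]]_n) :=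
  forall u : 'rV[R[i]]_n, 0 <= (u *m M *m (map_mx Num.conj u)^T) 0 0.

Definition character (R : realType) (G : groupType) (chi : G -> R[i]) :=
  [/\ forall g h, chi (g * h)%g = chi (h * g)%g,
      forall n (g : 'I_n -> G), psdmx (\matrix_(i, j) chi (g i * (g j)^-1)%g) &
      chi 1%g = 1].

Definition indecomposable (R : realType) (G : groupType) (chi : G -> R[i]) :=
  ~ exists (alpha : R) (chi1 chi2 : G -> R[i]),
    [/\ 0 < alpha < 1,
        character chi1, character chi2, chi1 <> chi2 &
        forall g, chi g =
          real_complex R alpha * chi1 g + real_complex R (1 - alpha) * chi2 g].

Definition fix_character (G : groupType) (R : realType) d
    (X : measurableType d) (mu : probability X R) (act : G -> X -> X)
    (g : G) : R[i] :=
  real_complex R (fine (mu (fixed_points act g))).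

(* Main.v *)
Require Import Defs.
From HB Require Import structures.
From mathcomp Require Import all_boot all_order all_algebra.
From mathcomp Require Import fingroup perm.
From mathcomp Require Import all_classical all_reals all_analysis.
From mathcomp Require Import ring.
Local Open Scope classical_set_scope.

Set Implicit Arguments.
Unset Strict Implicit.
Unset Printing Implicit Defensive.

Import Order.TTheory GRing.Theory Num.Theory.
Local Open Scope ring_scope.

(** The action is the symmetric group permuting N = n + 1 >= 3 points, each of
    mass 1 / N (N = 3 in the theorem). A Lebesgue space may have atoms, so this
    is one ([lebesgue_space_countable]), and the action is ergodic because it
    is transitive. It is totally non-free ([sym_totally_non_free]): the
    complement of the fixed-point set of a transposition is the pair of points
    it exchanges, and two such pairs can be made to meet in any given point.

    The character chi(g) = |Fix g| / N is the normalized trace of the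
    permutation matrices. These fix the constant vectors, so a copy of the
    trivial representation splits off ([sym_decomposable]):
      chi = (1 / N) * 1 + (1 - 1 / N) * chi2,   chi2(g) = (|Fix g| - 1) / n,
    where chi2 is the normalized trace on the vectors of sum zero. It is not 1,
    since a transposition moves a point. Both chi and chi2 are positive
    semi-definite because they are Gram kernels: up to a scalar, their value at
    g h^-1 is the inner product of the permutation matrices of g and h, with
    a constant subtracted from every entry, 0 for chi and 1 / N for chi2
    ([nfix_gram]). *)

(** * The uniform probability on finitely many points *)

HB.instance Definition _ n := isPointed.Build 'I_n.+1 ord0.
HB.instance Definition _ n := @isMeasurable.Build default_measure_display
  'I_n.+1 discrete_measurable discrete_measurable0
  discrete_measurableC discrete_measurableU.

Section uniform_measure.
Context {R : realType} (n : nat).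

Definition uniform_ord : set 'I_n.+1 -> \bar R :=
  mscale (n.+1%:R^-1)%:nng (msum (fun i => dirac (inord i : 'I_n.+1)) n.+1).

HB.instance Definition _ := Measure.on uniform_ord.

Lemma uniform_ordE (A : set 'I_n.+1) :
  uniform_ord A = (#|[set x | x \in A]%SET|%:R / n.+1%:R)%:E.
Proof.
rewrite /uniform_ord /mscale /= mulrC EFinM; congr (_ * _)%E; rewrite /msum.
under eq_bigr => i _ do rewrite inord_val [X in X A]/= diracE.
rewrite sumEFin cardsE -sum1_card natr_sum [in RHS]big_mkcond.
congr (_%:E); apply: eq_bigr => i _.
by rewrite [i \in in_set A](_ : _ = (i \in A)) //; case: (i \in A).
Qed.

Let uniform_ordT : uniform_ord setT = 1%E.
Proof.
rewrite uniform_ordE (_ : [set x | _]%SET = [set: 'I_n.+1]%SET); last first.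
  by apply/setP => x; rewrite !inE in_setT.
by rewrite cardsT card_ord divff.
Qed.

HB.instance Definition _ :=
  Measure_isProbability.Build _ _ _ uniform_ord uniform_ordT.

End uniform_measure.

(** All the points are taken as atoms. The interval that remains is
    [0, 0]: not empty, but null, so it is isomorphic mod 0 to the empty set. *)
Lemma lebesgue_space_countable (R : realType) d (X : measurableType d)
    (mu : probability X R) :
  countable [set: X] -> (forall A : set X, measurable A) -> lebesgue_space mu.
Proof.
move=> cX mX; split; first by move=> A _.
exists setT; split => //.
rewrite setCT measure0 /=; exists set0, set0, point; split.
- by split => //; rewrite ?setD0 ?measure0.
- split => //; rewrite setD0 set_itv1.
  exact: lebesgue_measure_set1.
- by split => [x []|x y /set_mem []|y []].
- by move=> S; rewrite subset0 => ->; rewrite image_set0; split.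
- by move=> S; rewrite subset0 => ->; rewrite image_set0 !measure0.
Qed.

(** * Positive semi-definite functions on a group *)

(** With F the matrix of rows f (g_i), the matrix of chi is a * F F^*, and
    u F F^* u^* is the squared norm of u F. *)
Lemma gram_psdmx (R : realType) (G : groupType) (K : finType)
    (f : G -> K -> R[i]) (a : R[i]) (chi : G -> R[i]) :
  0 <= a ->
  (forall g h, chi (g * h^-1)%g = a * \sum_k f g k * Num.conj (f h k)) ->
  forall m (g : 'I_m -> G), psdmx (\matrix_(i, j) chi (g i * (g j)^-1)%g).
Proof.
move=> a0 chiE m g u.
pose F := \matrix_(i < m, k < #|K|) f (g i) (enum_val k).
have -> : \matrix_(i, j) chi (g i * (g j)^-1)%g
    = a *: (F *m (map_mx Num.conj F)^T).
  apply/matrixP => i j; rewrite !mxE chiE; congr (_ * _).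
  rewrite (reindex (@enum_val K xpredT)) /=; last first.
    by apply: onW_bij; exact: enum_val_bij.
  by apply: eq_bigr => k _; rewrite !mxE.
rewrite -scalemxAr -scalemxAl mulmxA -(mulmxA (u *m F)) -trmx_mul -map_mxM mxE.
apply: mulr_ge0 => //; rewrite mxE; apply: sumr_ge0 => k _.
by rewrite !mxE mul_conjC_ge0.
Qed.

Lemma trivial_character (R : realType) (G : groupType) :
  character (fun _ : G => 1 : R[i]).
Proof.
split => // m g.
apply: (@gram_psdmx R G unit (fun _ _ => 1) 1 (fun=> 1)) => // {}g h.
by rewrite (big_pred1 tt) ?rmorph1 ?mulr1 // => -[].
Qed.

(** * The symmetric group acting on its points *)

Section symmetric_group.
Context (n : nat).
Local Notation T := 'I_n.+1.
Implicit Types g h : {perm T}.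

(** The product of permutations composes from left to right, so the inverse is
    what makes this a left action. *)
Definition sym_act (g : {perm T}) (x : T) : T := (g^-1)%g x.

Definition nfix g := #|[set x | g x == x]%SET|.

Lemma fixed_points_sym g : fixed_points sym_act g = [set x | g x = x].
Proof.
apply/seteqP; split => x; rewrite /fixed_points /sym_act /= => gx.
  by rewrite -{1}gx permKV.
by rewrite -{1}gx permK.
Qed.

(** The permutation g maps the fixed points of g * h onto those of h * g. *)
Lemma nfixM g h : nfix (g * h)%g = nfix (h * g)%g.
Proof.
rewrite /nfix -[LHS](card_imset _ (@perm_inj _ g)); congr #|pred_of_set _|.
apply/setP => y; rewrite !inE permM; apply/imsetP/eqP => [[x]|ghy].
  by rewrite inE permM => /eqP hgx ->; rewrite hgx.
by exists (h y); rewrite ?inE ?permM ghy.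
Qed.

Lemma nfix1 : nfix 1%g = n.+1.
Proof.
rewrite /nfix (_ : [set x | _]%SET = [set: T]%SET) ?cardsT ?card_ord //.
by apply/setP => x; rewrite !inE perm1 eqxx.
Qed.

(** Without c, the pair (x, y) contributes 1 when g x = y = h x, so the sum
    counts the x with g x = h x, that is the fixed points of g * h^-1. The other
    terms are the corrections for c, as every row of a permutation matrix has
    sum 1. *)
Lemma nfix_gram (C : comNzRingType) (c : C) g h :
  \sum_(p : T * T) ((g p.1 == p.2)%:R - c) * ((h p.1 == p.2)%:R - c)
  = (nfix (g * h^-1)%g)%:R - c * n.+1%:R *+ 2 + (c * n.+1%:R) ^+ 2.
Proof.
have delta (k : T) : \sum_y (k == y)%:R = 1 :> C.
  by rewrite (bigD1 k) //= eqxx big1 ?addr0 // => y /negPf;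
    rewrite eq_sym => ->.
have nfixE : (nfix (g * h^-1)%g)%:R = \sum_x (g x == h x)%:R :> C.
  rewrite /nfix -sum1dep_card natr_sum big_mkcond /=; apply: eq_bigr => x _.
  rewrite permM (can2_eq (permKV h) (permK h)).
  by case: eqP.
have delta2 (j k : T) : \sum_y (j == y)%:R * (k == y)%:R = (j == k)%:R :> C.
  rewrite (bigD1 k) //= eqxx mulr1 big1 ?addr0 // => y /negPf.
  by rewrite eq_sym => ->; rewrite mulr0.
transitivity (\sum_x ((g x == h x)%:R - c *+ 2 + c ^+ 2 * n.+1%:R)).
  rewrite -(pair_bigA _ (fun x y => ((g x == y)%:R - c) * ((h x == y)%:R - c))).
  apply: eq_bigr => x _ /=.
  transitivity (\sum_y ((g x == y)%:R * (h x == y)%:R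
                 + (- c * (g x == y)%:R + (- c * (h x == y)%:R + c ^+ 2)))).
    by apply: eq_bigr => y _; ring.
  rewrite !big_split /= -!mulr_sumr delta2 !delta sumr_const card_ord; ring.
rewrite !big_split /= -nfixE !sumr_const card_ord; ring.
Qed.

Lemma fix_character_sym (R : realType) g :
  fix_character (@uniform_ord R n) sym_act g = (nfix g)%:R / n.+1%:R :> R[i].
Proof.
rewrite /fix_character /= uniform_ordE /= fmorph_div !rmorph_nat.
congr (_%:R / _); rewrite fixed_points_sym /nfix; congr #|pred_of_set _|.
by apply/setP => x; rewrite !inE; apply/idP/eqP => [/set_mem|/mem_set].
Qed.

(** For c = 0 this is the character |Fix g| / N; for c = 1 / N the bracket is
    |Fix g| - 1. *)
Lemma nfix_character (R : realType) (a c : R[i]) (chi : {perm T} -> R[i]) :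
  0 <= a -> c \is Num.real ->
  (forall g, chi g =
     a * ((nfix g)%:R - c * n.+1%:R *+ 2 + (c * n.+1%:R) ^+ 2)) ->
  chi 1%g = 1 -> character chi.
Proof.
move=> a0 cR chiE chi1; split => // [g h|]; first by rewrite !chiE nfixM.
apply: (gram_psdmx (f := fun g (p : T * T) => (g p.1 == p.2)%:R - c) a0) => g h.
rewrite chiE -nfix_gram; congr (_ * _); apply: eq_bigr => p _.
by rewrite rmorphB /= rmorph_nat (CrealP cR).
Qed.

Lemma sym_preserving (R : realType) :
  measure_preserving_action (@uniform_ord R n) sym_act.
Proof.
split => //.
- by move=> x; rewrite /sym_act invg1 perm1.
- by move=> g h x; rewrite /sym_act invMg permM.
- move=> g A _; rewrite /= !uniform_ordE; congr (_%:R / _)%:E.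
  rewrite -[in RHS](card_preimset _ (@perm_inj _ g^-1%g)).
  congr #|pred_of_set _|.
  apply/setP => x; rewrite !inE; apply/idP/idP => /set_mem H;
    exact: mem_set.
Qed.

Lemma sym_ergodic (R : realType) : ergodic (@uniform_ord R n) sym_act.
Proof.
move=> A _ invA; have [->|/set0P[x Ax]] := eqVneq A set0.
  by left; rewrite measure0.
right; rewrite (_ : A = setT) ?probability_setT //; apply/seteqP; split => // y _.
by rewrite -(invA (tperm x y)) /= /sym_act tpermV tpermR.
Qed.

(** For distinct x, y, z, the transpositions (x y) and (x z) move only x in
    common; a third point z requires n > 1. Finite unions of points then give
    every set. *)
Lemma sym_totally_non_free (R : realType) :
  (1 < n)%N -> totally_non_free (@uniform_ord R n) sym_act.
Proof.
move=> n1; apply/seteqP; split => // A _.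
set S := [set N | _]; set F := range _.
have Smoved u v : (F `|` S).-sigma.-measurable [set w | tperm u v w <> w].
  apply: (@measurableC _ (g_sigma_algebraType (F `|` S))
            [set w | tperm u v w = w]).
  rewrite -fixed_points_sym.
  by apply: sub_sigma_algebra; left; exists (tperm u v).
have S1 x : (F `|` S).-sigma.-measurable [set x].
  have /card_gt1P[y [z [yx zx yz]]] : (1 < #|[set~ x]%SET|)%N.
    by rewrite cardsC1 card_ord.
  rewrite (_ : [set x] =
      [set w | tperm x y w <> w] `&` [set w | tperm x z w <> w]).
    exact: measurableI.
  rewrite !inE in yx zx.
  apply/seteqP; split => [_ -> /=|w /= []].
    by rewrite !tpermL; split; apply/eqP.
  case: tpermP => // -> _.
  by rewrite tpermD 1?eq_sym.
rewrite -[A]image_id -bigcup_imset1.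
apply: (@fin_bigcup_measurable _ (g_sigma_algebraType (F `|` S))) => [|x _].
  exact: finite_finset.
exact: S1.
Qed.

Lemma sym_decomposable (R : realType) :
  (0 < n)%N -> ~ indecomposable (fix_character (@uniform_ord R n) sym_act).
Proof.
move=> n0; apply.
exists (n.+1%:R^-1), (fun=> 1), (fun g => ((nfix g)%:R - 1) / n%:R); split.
- by rewrite invr_gt0 ltr0n invf_lt1 ?ltr0n // ltr1n.
- exact: trivial_character.
- apply: (@nfix_character _ (n%:R^-1) (n.+1%:R^-1)).
  + by rewrite invr_ge0 ler0n.
  + by rewrite rpredV realn.
  + by move=> g; rewrite mulVf ?pnatr_eq0 // expr1n mulrC; congr (_ * _);
    ring.
  + by rewrite nfix1 -natr1 addrK divff // pnatr_eq0 -lt0n.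
- (* If chi2 were 1, the transposition t would have N fixed points. *)
  pose t := tperm (ord0 : T) ord_max.
  move/(congr1 (@^~ t))/esym/divr1_eq/eqP.
  rewrite subr_eq natr1 eqr_nat => /eqP fixT.
  suff : ord0 \in [set x | t x == x]%SET.
    by rewrite inE tpermL -val_eqE /= eqn0Ngt n0.
  suff -> : [set x | t x == x]%SET = [set: T]%SET by rewrite inE.
  by apply/eqP; rewrite eqEcard finset.subsetT cardsT card_ord;
    exact: eq_leq (esym fixT).
- move=> g; rewrite fix_character_sym mulr1 rmorphB /= fmorphV rmorph_nat rmorph1.
  have N0 : n.+1%:R != 0 :> R[i] by rewrite pnatr_eq0.
  have n0' : n%:R != 0 :> R[i] by rewrite pnatr_eq0 -lt0n.
  rewrite -natr1 in N0 *; field; by rewrite n0' N0.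
Qed.

Lemma sym_fix_character (R : realType) :
  character (fix_character (@uniform_ord R n) sym_act).
Proof.
apply: (@nfix_character _ n.+1%:R^-1 0) => [|||].
- by rewrite invr_ge0 ler0n.
- exact: real0.
- by move=> g; rewrite fix_character_sym mulrC; congr (_ * _); ring.
- by rewrite fix_character_sym nfix1 divff // pnatr_eq0.
Qed.

End symmetric_group.

Theorem proposition28 (R : realType) :
  exists (G : groupType) (d : measure_display) (X : measurableType d)
         (mu : probability X R) (act : G -> X -> X),
    countable [set: G] /\
    lebesgue_space mu /\
    measure_preserving_action mu act /\
    ergodic mu act /\
    totally_non_free mu act /\
    character (fix_character mu act) /\
    ~ indecomposable (fix_character mu act).
Proof.
exists {perm 'I_3}, default_measure_display, 'I_3, (@uniform_ord R 2).
exists (@sym_act 2).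
split; first exact: countableP.
split; first by apply: lebesgue_space_countable => //; exact: countableP.
split; first exact: sym_preserving.
split; first exact: sym_ergodic.
split; first exact: sym_totally_non_free.
split; first exact: sym_fix_character.
exact: sym_decomposable.
Qed.
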